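(* There exist universal constants $A,B>0$ such that the following holds. Let $\{X_n\}_{n\ge1}$ be a sequence of pairwise independent real-valued random variables on a probability space $(\Omega,\mathbf{F},\mathbb{P})$, each with expected value $0$ and finite variance. Let $S_n:=\sum_{k=1}^n X_k$ and $z_n:=\sum_{i=1}^n\mathbb{E}(|X_i|)$. Further, assume $$\sum_{n=1}^\infty\frac{\mathrm{Var}(X_n)}{n^2}\le\Gamma$$ for some $\Gamma\ge1$ and that the partial sums of this series converge to their limit with a strictly decreasing rate of convergence $\Psi$. Furthermore, assume that for all $n\ge 1$, $$\frac{z_n}{n}\le W$$ for some $W\ge1$. Then for all $0<\varepsilon\le1$, all $\lambda>0$ and all integers $n\ge 1$ with $$n\ge A\left(\frac{W\Gamma}{\lambda\varepsilon^3}\right)^{\frac12}\Psi\left(\frac{B\lambda\varepsilon^3}{W}\right),$$ it holds that $$\mathbb{P}\left(\sup_{m\ge n}\left|\frac{S_m}{m}\right|>\varepsilon\right)\le\lambda.$$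
   Context: A rate of convergence for the partial sums of a convergent series $\sum_{i=1}^\infty x_i<\infty$ of nonnegative reals is a function $r:(0,\infty)\to(0,\infty)$ such that for all $\varepsilon>0$ and all natural numbers $n\ge r(\varepsilon)$, $\sum_{i=n+1}^\infty x_i\le\varepsilon$.
   Formalization: In the lower bound on n, the factor Ψ(Bλε³/W) is replaced by max(1, Ψ(Bλε³/W)), since the claim fails for rates with values below 1 (e.g. X_1=±1, X_n=0 for n≥2, Ψ(e)=c/(1+e) with small c). *)

(* Defs.v *)
(* MathComp-Analysis *)
From mathcomp Require Export all_boot all_order all_algebra.
From mathcomp Require Export all_classical all_reals all_analysis.

Set Implicit Arguments.
Unset Strict Implicit.
Unset Printing Implicit Defensive.

Import Order.TTheory GRing.Theory Num.Theory.

Local Open Scope classical_set_scope.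
Local Open Scope ring_scope.
Local Open Scope ereal_scope.

Definition independent_RV d (T : measurableType d) (R : realType)
    (P : probability T R) (X Y : {RV P >-> R}) : Prop :=
  forall A B : set R, measurable A -> measurable B ->
    P (X @^-1` A `&` Y @^-1` B) = P (X @^-1` A) * P (Y @^-1` B).

(* Sequences are indexed from 1; the value at index 0 is never used. *)
Definition pairwise_independent_RV d (T : measurableType d) (R : realType)
    (P : probability T R) (X : nat -> {RV P >-> R}) : Prop :=
  forall i j : nat, (1 <= i)%N -> (1 <= j)%N -> i <> j ->
    independent_RV (X i) (X j).

Definition S_ d (T : measurableType d) (R : realType)
    (P : probability T R) (X : nat -> {RV P >-> R}) (n : nat) (w : T) : R :=
  (\sum_(1 <= k < n.+1) X k w)%R.

Definition z_ d (T : measurableType d) (R : realType)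
    (P : probability T R) (X : nat -> {RV P >-> R}) (n : nat) : \bar R :=
  \sum_(1 <= i < n.+1) 'E_P[(fun w => `|X i w|%R)].

(* r : (0, oo) -> (0, oo) is a total function whose values outside (0, oo)
   are irrelevant; x is meant to be a sequence of nonnegative finite terms. *)
Definition rate_of_convergence (R : realType) (x : nat -> \bar R)
    (r : R -> R) : Prop :=
  forall e : R, (0 < e)%R ->
    (0 < r e)%R /\
    forall n : nat, (r e <= n%:R)%R -> \sum_(n.+1 <= i <oo) x i <= e%:E.

Definition strictly_decreasing_pos (R : realType) (r : R -> R) : Prop :=
  forall a b : R, (0 < a)%R -> (a < b)%R -> (r b < r a)%R.

(* Main.v *)
Require Import Defs.
From mathcomp Require Import all_boot all_order all_algebra.
From mathcomp Require Import all_classical all_reals all_analysis.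
From mathcomp Require Import measurable_realfun ring lra.

Import Order.TTheory GRing.Theory Num.Theory.

Local Open Scope classical_set_scope.
Local Open Scope ring_scope.
Local Open Scope ereal_scope.

Set Implicit Arguments.
Unset Strict Implicit.

(** The proof quantifies the Csorgo-Tandori-Totik strengthening of Etemadi's
    proof of the strong law of large numbers.

    Split X_k into its positive and negative parts.  Both sequences of parts
    are again pairwise independent, hence uncorrelated [covariance_indep], with
    variances at most Var X_k [variance_dom], and their partial sums T_m are
    now nondecreasing in m.  Since E X_k = 0, the two centering terms E T_m
    cancel, so |S_m| > eps m forces one of the two deviations |T_m - E T_m| to
    exceed eps m / 2 [deviation_decomposition].

    Fix a dyadic block L <= m <= 2L and cut it into cells on which E T_m varies
    by at most a fixed fraction of eps L.  As E T_m <= W m, about W / eps cells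
    suffice [plateau_cover].  By monotonicity, a large deviation of T_m inside
    a cell forces a deviation of comparable size at one of the two ends of the
    cell, and Chebyshev's inequality applies to these finitely many indices
    only [exceedance_cells].  The block thus costs at most a constant times
    W / eps^3 times L^-2 sum_(k <= 2L) Var X_k [exceedance_block].

    Over the blocks L = 2^j n, the variable X_k receives the total weight
    sum_j [k <= 2^(j+1) n] (2^j n)^-2, at most a constant times
    min(n^-2, k^-2) [dyadic_weight_le].  With N just above the rate Psi(e), the
    terms k <= N contribute at most (N/n)^2 Gamma and the terms k > N at most
    e [dyadic_sum_le], up to the common factor W / eps^3 [sup_average_tail].
    With e = lambda eps^3 / (8192 W), the second contribution is at most
    lambda / 2, and the lower bound on n does the same for the first one. *)

(** * Independence, square integrability and partial sums *)

Section prob.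
Context d (T : measurableType d) (R : realType) (P : probability T R).

(** Independence on rectangles determines the joint law as the product of the
    marginals, so Tonelli's theorem factorizes the expectation. *)
Lemma ge0_expectationM_indep (X Y : {RV P >-> R}) (f g : R -> R) :
  independent_RV X Y ->
  measurable_fun [set: R] f -> measurable_fun [set: R] g ->
  (forall x, 0 <= f x)%R -> (forall x, 0 <= g x)%R ->
  'E_P[(f \o X) * (g \o Y)] = 'E_P[f \o X] * 'E_P[g \o Y].
Proof.
move=> XY mf mg f0 g0.
pose XY_ : T -> R * R := fun w => (X w, Y w).
have mXY : measurable_fun [set: T] XY_ by exact: measurable_fun_pair.
pose h : R * R -> \bar R := fun z => (f z.1 * g z.2)%:E.
have mh : measurable_fun setT h.
  apply/measurable_EFinP; apply: measurable_funM.
    exact: (measurableT_comp mf).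
  exact: (measurableT_comp mg).
have h0 z : 0 <= h z by rewrite lee_fin mulr_ge0.
have -> : 'E_P[(f \o X) * (g \o Y)] = \int[pushforward P XY_]_z h z.
  by rewrite unlock ge0_integral_pushforward.
pose m1 := distribution P X; pose m2 := distribution P Y.
have -> : \int[pushforward P XY_]_z h z = \int[m1 \x m2]_z h z.
  apply: eq_measure_integral => A mA _.
  by symmetry; apply: (@product_measure_unique _ _ _ _ _ m1 m2).
rewrite fubini_tonelli1//.
rewrite /fubini_F /h/=.
under eq_integral => x _.
  rewrite (eq_integral (fun y => (f x)%:E * (g y)%:E)); last by move=> y _; rewrite EFinM.
  rewrite ge0_integralZl_EFin//; last 2 first.
    by move=> y _; rewrite lee_fin.
    exact/measurable_EFinP.
  over.
rewrite ge0_integralZr//; last 3 first.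
  exact/measurable_EFinP.
  by move=> y _; rewrite lee_fin.
  by apply: integral_ge0 => y _; rewrite lee_fin.
rewrite unlock; congr (_ * _).
  by rewrite ge0_integral_distribution//; exact/measurable_EFinP.
by rewrite ge0_integral_distribution//; exact/measurable_EFinP.
Qed.

Let Pfin : P [set: T] \is a fin_num := fin_num_measure P _ measurableT.

Lemma covariance_indep (X Y : {RV P >-> R}) (f g : R -> R) :
  independent_RV X Y ->
  measurable_fun [set: R] f -> measurable_fun [set: R] g ->
  (forall x, 0 <= f x)%R -> (forall x, 0 <= g x)%R ->
  f \o X \in Lfun P 2%:E -> g \o Y \in Lfun P 2%:E ->
  covariance P (f \o X) (g \o Y) = 0.
Proof.
move=> XY mf mg f0 g0 fX gY.
have fX1 := Lfun_subset12 Pfin fX; have gY1 := Lfun_subset12 Pfin gY.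
rewrite covarianceE ?Lfun2_mul_Lfun1//.
by rewrite ge0_expectationM_indep// subee// fin_numM ?expectation_fin_num.
Qed.

Lemma expectation_sqr_le (X Y : T -> R) : measurable_fun [set: T] X ->
  measurable_fun [set: T] Y ->
  (forall w, `|Y w| <= `|X w|)%R -> 'E_P[Y ^+ 2] <= 'E_P[X ^+ 2].
Proof.
move=> mX mY YX; apply: expectation_le.
- exact: (measurable_funM (_ : measurable_fun _ _) (_ : measurable_fun _ _)).
- exact: (measurable_funM (_ : measurable_fun _ _) (_ : measurable_fun _ _)).
- by move=> w; exact: sqr_ge0.
- by move=> w; exact: sqr_ge0.
- apply: aeW => w /=; rewrite -[X in (X <= _)%R]real_normK ?num_real//.
  by rewrite -[X in (_ <= X)%R]real_normK ?num_real// lerXn2r ?nnegrE.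
Qed.

Lemma Lfun2_sqr (X : T -> R) : measurable_fun [set: T] X ->
  'E_P[X ^+ 2] < +oo -> X \in Lfun P 2%:E.
Proof.
move=> mX EX; rewrite inE; apply/andP; split; rewrite inE//=.
rewrite /finite_norm unlock /Lnorm poweR_lty//.
move: EX; rewrite unlock; congr (_ < _); apply: eq_integral => w _ /=.
by rewrite powR_mulrn// real_normK ?num_real.
Qed.

Lemma Lfun_measurable (X : T -> R) p : X \in Lfun P p -> measurable_fun [set: T] X.
Proof. by move=> /sub_Lfun_mfun; rewrite inE. Qed.

Lemma Lfun2_dom (X Y : T -> R) : measurable_fun [set: T] Y ->
  X \in Lfun P 2%:E -> (forall w, `|Y w| <= `|X w|)%R -> Y \in Lfun P 2%:E.
Proof.
move=> mY X2 YX; apply: Lfun2_sqr => //.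
apply: le_lt_trans (expectation_sqr_le (Lfun_measurable X2) mY YX) _.
by rewrite unlock; exact: integrable_lty (Lfun2_integrable_sqr X2).
Qed.

(** A finite variance alone yields square integrability once the mean is known
    to be 0, because the variance is then the second moment itself. *)
Lemma Lfun2_centered (X : {RV P >-> R}) : 'E_P[X] = 0 -> 'V_P[X] < +oo ->
  (X : T -> R) \in Lfun P 2%:E.
Proof.
move=> EX VX; apply: Lfun2_sqr => //.
move: VX; rewrite /variance unlock EX/=; congr ('E_P[_] < _).
by apply/funext => w; rewrite expr2 !fctE /= subr0.
Qed.

(** Var Y <= E Y^2 <= E X^2, and the last term is Var X because X is centered. *)
Lemma variance_dom (X Y : T -> R) : measurable_fun [set: T] Y ->
  X \in Lfun P 2%:E -> 'E_P[X] = 0 ->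
  (forall w, `|Y w| <= `|X w|)%R -> 'V_P[Y] <= 'V_P[X].
Proof.
move=> mY X2 EX YX; have Y2 := Lfun2_dom mY X2 YX.
have Y1 := Lfun_subset12 Pfin Y2.
have mX := Lfun_measurable X2.
rewrite !varianceE// EX [X in _ <= _ - X]expe2 mule0 sube0.
apply: le_trans (expectation_sqr_le mX mY YX).
rewrite leeBlDr ?fin_numX ?expectation_fin_num//.
by rewrite leeDl// expe2 -(fineK (expectation_fin_num Y1)) -EFinM lee_fin sqr_ge0.
Qed.

(** A pointwise sum rather than a sum in the function space: this is the shape
    of [S_]. *)
Definition psum (Y : nat -> T -> R) n (w : T) : R :=
  (\sum_(1 <= k < n.+1) Y k w)%R.

Lemma psum0 Y : psum Y 0 = cst 0%R.
Proof. by apply/funext => w; rewrite /psum big_geq. Qed.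

Lemma psumS Y n : psum Y n.+1 = (psum Y n \+ Y n.+1)%R.
Proof. by apply/funext => w; rewrite /psum big_nat_recr. Qed.

Lemma psum_Lfun (Y : nat -> T -> R) r n : (1 <= r)%R ->
  (forall k, (1 <= k)%N -> Y k \in Lfun P r%:E) -> psum Y n \in Lfun P r%:E.
Proof.
move=> r1 Y2; elim: n => [|n IH]; first by rewrite psum0 Lfun_cst.
by rewrite psumS rpredD ?lee_fin// Y2.
Qed.

Lemma expectation_psum (Y : nat -> T -> R) n :
  (forall k, (1 <= k)%N -> Y k \in Lfun P 1) ->
  'E_P[psum Y n] = \sum_(1 <= k < n.+1) 'E_P[Y k].
Proof.
move=> Y1; elim: n => [|n IH]; first by rewrite psum0 big_geq// expectation_cst.
by rewrite psumS big_nat_recr//= expectationD ?IH ?Y1// psum_Lfun.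
Qed.

Lemma variance_psum (Y : nat -> T -> R) n :
  (forall k, (1 <= k)%N -> Y k \in Lfun P 2%:E) ->
  (forall i j, (1 <= i)%N -> (1 <= j)%N -> i <> j -> covariance P (Y i) (Y j) = 0) ->
  'V_P[psum Y n] = \sum_(1 <= k < n.+1) 'V_P[Y k].
Proof.
move=> Y2 Y0.
have S2 m : psum Y m \in Lfun P 2%:E by rewrite psum_Lfun ?ler1n.
have cov m j : (m < j)%N -> covariance P (psum Y m) (Y j) = 0.
  elim: m => [_|m IH mj]; first by rewrite psum0 covariance_cst_l.
  have j0 : (0 < j)%N by exact: leq_trans mj.
  rewrite psumS covarianceDl ?IH ?add0e ?Y0 ?Y2//; last exact: ltnW.
  by move=> mj'; rewrite mj' ltnn in mj.
elim: n => [|n IH]; first by rewrite psum0 variance_cst big_geq.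
by rewrite psumS big_nat_recr//= varianceD ?Y2// IH cov// mule0 adde0.
Qed.

(** Chebyshev's inequality with a real right-hand side, for plain functions, so
    that partial sums need no bundled measurability. *)
Lemma chebyshev_Lfun2 (X : T -> R) (e : R) : X \in Lfun P 2%:E -> (0 < e)%R ->
  P [set w | (e <= `|X w - fine 'E_P[X]|)%R] <= (e ^- 2 * fine 'V_P[X])%:E.
Proof.
move=> X2 e0; rewrite EFinM fineK ?variance_fin_num//.
exact: (chebyshev (mfun_Sub (sub_Lfun_mfun X2)) e0).
Qed.

End prob.

(** * The maximal inequality on a block *)

(** Sort the indices m of the block by the integer part of a m / delta.  At most
    K + 1 values occur, and pq i holds the smallest and the largest index with
    value i, between which the monotone function a varies by at most delta. *)
Lemma plateau_cover (R : realType) (a : nat -> R) (L H K : nat) (delta : R) :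
  (L <= H)%N -> (0 < delta)%R -> (forall m, 0 <= a m)%R ->
  {homo a : m n / (m <= n)%N >-> (m <= n)%R} -> (a H < K.+1%:R * delta)%R ->
  exists pq : nat -> nat * nat,
    (forall i, ((pq i).1 <= H)%N /\ ((pq i).2 <= H)%N) /\
    forall m, (L <= m <= H)%N -> exists i, (i < K.+1)%N /\
      ((pq i).1 <= m <= (pq i).2)%N /\ (a (pq i).2 - a (pq i).1 <= delta)%R.
Proof.
move=> LH d0 a0 amono aH.
pose cell m := Num.truncn (a m / delta).
have cellP m : ((cell m)%:R * delta <= a m < (cell m).+1%:R * delta)%R.
  have := @truncn_itv R (a m / delta) (divr_ge0 (a0 m) (ltW d0)).
  by rewrite ler_pdivlMr// ltr_pdivrMr.
have /choice[pq pqP] : forall i, exists u : nat * nat,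
    ((u.1 <= H)%N /\ (u.2 <= H)%N) /\
    forall m, (L <= m <= H)%N -> cell m = i ->
      (u.1 <= m <= u.2)%N /\ (a u.2 - a u.1 <= delta)%R.
  move=> i; pose Q m := (L <= m <= H)%N && (cell m == i).
  have [[m0 Qm0]|noQ] := pselect (exists m, Q m); last first.
    (* For an empty cell, any pair of indices at most H will do. *)
    exists (L, L); split=> // m mLH mi; exfalso; apply: noQ.
    by exists m; rewrite /Q mLH mi eqxx.
  have exQ : exists m, Q m by exists m0.
  have Qb m : Q m -> (m <= H)%N by case/andP => /andP[].
  case: (ex_minnP exQ) => p Qp minp; case: (ex_maxnP exQ Qb) => q Qq maxq.
  exists (p, q) => /=; split; first by split; exact: Qb.
  move=> m mLH mi; have Qm : Q m by rewrite /Q mLH mi eqxx.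
  split; first by rewrite minp// maxq.
  have /andP[_ /eqP ci] := Qp; have /andP[_ /eqP cj] := Qq.
  have /andP[+ _] := cellP p; have /andP[_ +] := cellP q.
  by rewrite ci cj -natr1; lra.
exists pq; split; first by move=> i; have [] := pqP i.
move=> m /[dup] mLH /andP[_ mH]; exists (cell m); split.
  rewrite -(ltr_nat R) -(ltr_pM2r d0).
  have /andP[+ _] := cellP m => /le_lt_trans; apply.
  by apply: le_lt_trans aH; exact: amono.
by have [_] := pqP (cell m); apply.
Qed.

Section max.
Context d (T : measurableType d) (R : realType) (P : probability T R).
Let Pfin : P [set: T] \is a fin_num := fin_num_measure P _ measurableT.

Lemma measurable_gt (f : T -> R) c : measurable_fun [set: T] f ->
  measurable [set w | (c < f w)%R].
Proof.
move=> mf; have := mf measurableT _ (measurable_itv `]c, +oo[%R).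
rewrite setTI; congr measurable.
by apply/seteqP; split => w /=; rewrite in_itv/= andbT.
Qed.

Definition deviation (Y : nat -> T -> R) (m : nat) (c : R) : set T :=
  [set w | (c < `|psum Y m w - fine 'E_P[psum Y m]|)%R].

Section block.
Variable Y : nat -> T -> R.
Hypothesis Y2 : forall k, (1 <= k)%N -> Y k \in Lfun P 2%:E.
Hypothesis Y0 : forall i j, (1 <= i)%N -> (1 <= j)%N -> i <> j ->
  covariance P (Y i) (Y j) = 0.
Hypothesis Yge0 : forall k w, (1 <= k)%N -> (0 <= Y k w)%R.

Let S2 m : psum Y m \in Lfun P 2%:E.
Proof. by rewrite psum_Lfun ?ler1n. Qed.
Let S1 m : psum Y m \in Lfun P 1.
Proof. exact: Lfun_subset12 Pfin _ (S2 m). Qed.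

Lemma measurable_deviation m c : measurable (deviation Y m c).
Proof.
apply: measurable_gt; apply: measurableT_comp => //; apply: measurable_funB => //.
exact: Lfun_measurable (S2 m).
Qed.

Lemma psum_homo w : {homo (psum Y ^~ w) : m n / (m <= n)%N >-> (m <= n)%R}.
Proof.
apply: homo_leq => [x|y x z|n]; [exact: lexx|exact: le_trans|].
by rewrite psumS/= lerDl Yge0.
Qed.

Lemma mean_psum_ge0 m : (0 <= fine 'E_P[psum Y m])%R.
Proof.
apply/fine_ge0/expectation_ge0 => w; rewrite /psum.
by rewrite big_nat_cond sumr_ge0// => k /andP[/andP[k1 _] _]; exact: Yge0.
Qed.

Lemma mean_psum_homo :
  {homo (fun m => fine 'E_P[psum Y m]) : m n / (m <= n)%N >-> (m <= n)%R}.
Proof.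
apply: homo_leq => [x|y x z|n]; [exact: lexx|exact: le_trans|].
have Y1 : Y n.+1 \in Lfun P 1 by exact: Lfun_subset12 Pfin _ (Y2 _).
rewrite psumS expectationD// fineD ?expectation_fin_num// lerDl.
by apply/fine_ge0/expectation_ge0 => w; exact: Yge0.
Qed.

Lemma variance_psum_homo :
  {homo (fun m => fine 'V_P[psum Y m]) : m n / (m <= n)%N >-> (m <= n)%R}.
Proof.
apply: homo_leq => [x|y x z|n]; [exact: lexx|exact: le_trans|].
rewrite fine_le ?variance_fin_num// !variance_psum//.
by rewrite [leRHS]big_nat_recr//= leeDl// variance_ge0.
Qed.

(** Variances of partial sums grow with m, so one bound at the end H of the block
    serves every index of the block. *)
Lemma deviation_le m H c : (0 < c)%R -> (m <= H)%N ->
  P (deviation Y m c) <= (c ^- 2 * fine 'V_P[psum Y H])%:E.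
Proof.
move=> c0 mH; apply: (@le_trans _ _ (c ^- 2 * fine 'V_P[psum Y m])%:E).
  apply: le_trans (chebyshev_Lfun2 (S2 m) c0).
  have mS := Lfun_measurable (S2 m).
  apply: le_measure; rewrite ?inE.
  - exact: measurable_deviation.
  - rewrite (_ : [set _ | _] = ~` [set w | (- c < - `|psum Y m w - fine 'E_P[psum Y m]|)%R]).
      apply/measurableC/measurable_gt/measurableT_comp => //.
      by apply: measurableT_comp => //; apply: measurable_funB.
    by apply/seteqP; split => w /=; rewrite ltrN2 leNgt => /negP.
  - by move=> w /=; exact: ltW.
rewrite lee_fin; apply: ler_wpM2l; first by rewrite invr_ge0 exprn_ge0// ltW.
exact: variance_psum_homo.
Qed.

Definition exceedance (L H : nat) (c : R) : set T :=
  \bigcup_(m in [set m | L <= m <= H]%N) deviation Y m c.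

Lemma measurable_exceedance L H c : measurable (exceedance L H c).
Proof. by apply: bigcup_measurable => m _; exact: measurable_deviation. Qed.

(** Within a cell, with ends p <= m <= q, both psum Y and its mean are
    nondecreasing and the mean varies by at most c.  An upward deviation by 2c
    at m therefore persists as one by c at q, and a downward one as one by c
    at p. *)
Lemma exceedance_cells (L H K : nat) (c : R) :
  (L <= H)%N -> (0 < c)%R -> (fine 'E_P[psum Y H] < K.+1%:R * c)%R ->
  P (exceedance L H (2 * c)) <=
    (K.+1%:R * (2 * (c ^- 2 * fine 'V_P[psum Y H])))%:E.
Proof.
move=> LH c0 aH.
have [pq [pqH pqP]] := plateau_cover LH c0 mean_psum_ge0 mean_psum_homo aH.
pose B i := deviation Y (pq i).1 c `|` deviation Y (pq i).2 c.
have mB i : measurable (B i) by apply: measurableU; exact: measurable_deviation.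
have EB : exceedance L H (2 * c) `<=` \big[setU/set0]_(i < K.+1) B i.
  move=> w [m /pqP[i [iK [/andP[pm mq] aqp]]] /= dev].
  rewrite -bigcup_mkord; exists i => //.
  have := psum_homo w pm; have := psum_homo w mq.
  have := mean_psum_homo pm; have := mean_psum_homo mq; rewrite /= => h1 h2 h3 h4.
  move: dev; rewrite /deviation/= ltr_normr => /orP[] dev; [right|left];
    rewrite /deviation/= ltr_normr; apply/orP; [left|right]; lra.
apply: (le_trans (@content_subadditive _ _ _ P _ B K.+1 (fun i _ => mB i)
  (measurable_exceedance L H _) EB)).
rewrite mulr_natl -[K.+1 in leRHS]card_ord -sumr_const -sumEFin.
apply: lee_sum => i _; have [pH qH] := pqH i.
apply: (le_trans (measureU2 _ _ _)); [exact: measurable_deviation..|].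
by rewrite mulr2n mulrDl !mul1r EFinD; apply: leeD; exact: deviation_le.
Qed.

(** The cells have height c = eta L / 2, and the mean at the end of the block is at
    most 2 W L = (4 W / eta) c, so K + 1 <= 4 W / eta + 1 <= 5 W / eta cells
    suffice.  Each of them costs two Chebyshev bounds with the factor
    c^-2 = 4 / (eta L)^2, whence the constant 5 * 2 * 4 = 40. *)
Lemma exceedance_block (L : nat) (W eta : R) : (0 < L)%N -> (1 <= W)%R ->
  (0 < eta)%R -> (eta <= 1)%R ->
  (fine 'E_P[psum Y L.*2] <= W * (L.*2)%:R)%R ->
  P (exceedance L L.*2 (eta * L%:R)) <=
    (40 * W / eta ^+ 3 * (L%:R ^- 2 * fine 'V_P[psum Y L.*2]))%:E.
Proof.
move=> L0 W1 e0 e1 aW.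
have L0' : (0 < L%:R :> R)%R by rewrite ltr0n.
pose c := (eta * L%:R / 2)%R.
have c0 : (0 < c)%R by rewrite divr_gt0 ?mulr_gt0.
have -> : (eta * L%:R = 2 * c)%R by rewrite /c; field.
pose K := Num.truncn (4 * W / eta).
have h0 : (0 <= 4 * W / eta)%R by rewrite divr_ge0 ?(ltW e0)// mulr_ge0// (le_trans ler01).
have /andP[K1 K2] := truncn_itv h0.
have aK : (fine 'E_P[psum Y L.*2] < K.+1%:R * c)%R.
  apply: le_lt_trans aW _.
  rewrite (_ : W * (L.*2)%:R = 4 * W / eta * c)%R; last first.
    by rewrite /c -mul2n natrM; field; rewrite gt_eqF.
  by rewrite ltr_pM2r.
apply: le_trans (exceedance_cells _ c0 aK) _; first by rewrite -addnn leq_addr.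
have V0 : (0 <= fine 'V_P[psum Y L.*2])%R by rewrite fine_ge0// variance_ge0.
rewrite lee_fin.
rewrite [leRHS](_ : _ = 5 * W / eta * (2 * (c ^- 2 * fine 'V_P[psum Y L.*2])))%R; last first.
  by rewrite /c; field; rewrite !gt_eqF.
apply: ler_wpM2r; first by rewrite !mulr_ge0// invr_ge0 exprn_ge0// ltW.
rewrite -natr1; apply: (@le_trans _ _ (4 * W / eta + 1)%R); first by rewrite lerD2r.
rewrite -lerBrDl -mulrBl ler_pdivlMr//; lra.
Qed.

End block.
End max.

(** Applying a fixed measurable f with 0 <= f x <= |x| preserves pairwise
    independence and only decreases means of absolute values and variances, so
    the block inequality for f(X_k) is controlled by W and by the variances of
    the original variables.  It serves for both the positive and the negative
    part. *)
Lemma exceedance_transform d (T : measurableType d) (R : realType)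
    (P : probability T R) (X : nat -> {RV P >-> R}) (f : R -> R)
    (L : nat) (W eta : R) :
  pairwise_independent_RV X ->
  (forall k, (1 <= k)%N -> 'E_P[X k] = 0 /\ 'V_P[X k] < +oo) ->
  measurable_fun [set: R] f -> (forall x, 0 <= f x <= `|x|)%R ->
  (forall n : nat, (1 <= n)%N -> z_ X n * (n%:R^-1)%:E <= W%:E) ->
  (0 < L)%N -> (1 <= W)%R -> (0 < eta)%R -> (eta <= 1)%R ->
  P (exceedance P (fun k => f \o X k) L L.*2 (eta * L%:R)) <=
    (40 * W / eta ^+ 3 *
      (L%:R ^- 2 * \sum_(1 <= k < L.*2.+1) fine 'V_P[X k]))%:E.
Proof.
move=> indX momX mf fx zW L0 W1 e0 e1.
pose Y k := f \o X k.
have Pfin : P [set: T] \is a fin_num := fin_num_measure P _ measurableT.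
have f0 x : (0 <= f x)%R by have /andP[] := fx x.
have X2 k : (1 <= k)%N -> (X k : T -> R) \in Lfun P 2%:E.
  by move=> /momX[]; exact: Lfun2_centered.
have mY k : measurable_fun [set: T] (Y k) by exact: measurableT_comp.
have YX k w : (`|Y k w| <= `|X k w|)%R.
  by rewrite /Y/= ger0_norm//; have /andP[] := fx (X k w).
have Y2 k : (1 <= k)%N -> Y k \in Lfun P 2%:E.
  by move=> k1; exact: Lfun2_dom (mY k) (X2 k k1) (YX k).
have Yunc i j : (1 <= i)%N -> (1 <= j)%N -> i <> j -> covariance P (Y i) (Y j) = 0.
  by move=> i1 j1 ij; apply: covariance_indep => //; [exact: indX|exact: Y2|exact: Y2].
have Y0 k w : (1 <= k)%N -> (0 <= Y k w)%R by move=> _; exact: f0.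
have Y1 k : (1 <= k)%N -> Y k \in Lfun P 1.
  by move=> k1; exact: Lfun_subset12 Pfin _ (Y2 k k1).
have H0 : (0 < L.*2)%N by rewrite double_gt0.
have meanY : (fine 'E_P[psum Y L.*2] <= W * (L.*2)%:R)%R.
  rewrite -lee_fin fineK; last first.
    by rewrite expectation_fin_num// psum_Lfun.
  have := zW _ H0; rewrite lee_pdivrMr ?ltr0n// -EFinM; apply: le_trans.
  rewrite expectation_psum//; apply: lee_sum => k _.
  apply: expectation_le => //.
  - exact: measurableT_comp.
  - by move=> w; exact: f0.
  - by apply: aeW => w; have /andP[] := fx (X k w).
apply: le_trans (exceedance_block Y2 Yunc Y0 L0 W1 e0 e1 meanY) _.
rewrite lee_fin; apply: ler_wpM2l.
  by rewrite divr_ge0// ?mulr_ge0 ?exprn_ge0// ?(ltW e0)// (le_trans ler01).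
apply: ler_wpM2l; first by rewrite invr_ge0 exprn_ge0.
rewrite -lee_fin fineK; last by rewrite variance_fin_num// psum_Lfun ?ler1n.
rewrite variance_psum// -sumEFin big_nat_cond [leRHS]big_nat_cond.
apply: lee_sum => k /andP[/andP[k1 _] _].
have [EX _] := momX k k1.
by rewrite fineK ?variance_fin_num ?X2//; exact: variance_dom (mY k) (X2 k k1) EX (YX k).
Qed.

(** * Summing over dyadic blocks *)

Section dyadic.
Context (R : realFieldType).
Local Open Scope ring_scope.

(** With u_j = (2^j n)^-2 and b = 4 / k^2, a term is present only if u_j <= b, and
    then equals 4/3 (min(u_j, b) - min(u_(j+1), b)) because u_(j+1) = u_j / 4.
    The sum is thus dominated by a telescoping one. *)
Lemma dyadic_weight_le (n k J : nat) : (0 < n)%N -> (0 < k)%N ->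
  \sum_(j < J) (if (k <= (2 ^ j * n).*2)%N then (2 ^ j * n)%:R ^- 2 else 0) <=
    4 / 3 * Num.min (n%:R ^- 2) (4 * k%:R ^- 2) :> R.
Proof.
move=> n0 k0.
have k0' : 0 < k%:R :> R by rewrite ltr0n.
pose u j : R := (2 ^ j * n)%:R ^- 2.
have u0 j : 0 < u j by rewrite /u invr_gt0 exprn_gt0// ltr0n muln_gt0 expn_gt0.
have uS j : u j.+1 = u j / 4.
  by rewrite /u expnS -mulnA natrM exprMn invfM [LHS]mulrC -(natrX _ 2 2).
pose b : R := 4 * k%:R ^- 2; pose g j := Num.min (u j) b.
suff H : \sum_(j < J) (if (k <= (2 ^ j * n).*2)%N then u j else 0) <= 4 / 3 * (g 0%N - g J).
  apply: le_trans H _; rewrite /g /u expn0 mul1n -/b ler_pM2l// lerBlDr lerDl.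
  by rewrite le_min (ltW (u0 J))/= /b mulr_ge0// invr_ge0 exprn_ge0// ltW.
elim: J => [|J IH]; first by rewrite big_ord0 subrr mulr0.
rewrite big_ord_recr/=; apply: le_trans (lerD IH (lexx _)) _.
have -> : 4 / 3 * (g 0%N - g J.+1) = 4 / 3 * (g 0%N - g J) + 4 / 3 * (g J - g J.+1) by ring.
apply: lerD => //; case: ifPn => [kJ|_].
  have ub : u J <= b.
    rewrite /u /b -[4 * _]invrK lef_pV2 ?posrE ?invr_gt0 ?mulr_gt0 ?invr_gt0 ?exprn_gt0// ?ltr0n ?muln_gt0 ?expn_gt0//.
    rewrite invfM invrK.
    have : k%:R <= 2 * (2 ^ J * n)%:R :> R by rewrite -natrM ler_nat mul2n.
    move: (2 ^ J * n)%:R => x kx; have := lerXn2r 2 (_ : k%:R \is Num.nneg) (_ : 2 * x \is Num.nneg) kx.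
    rewrite !nnegrE exprMn => /(_ (ltW k0') (le_trans (ltW k0') kx)); lra.
  have -> : g J = u J by apply/min_idPl.
  have -> : g J.+1 = u J.+1 by apply/min_idPl; rewrite uS; have := u0 J; lra.
  by rewrite uS; have := u0 J; lra.
rewrite mulr_ge0// subr_ge0 /g le_min ge_min uS; apply/andP; split.
  by apply/orP; left; have := u0 J; lra.
by rewrite ge_min lexx orbT.
Qed.

(** After exchanging the sums, and up to constants, k <= N uses the weight bound
    n^-2 = (k/n)^2 k^-2 <= (N/n)^2 k^-2, and k > N uses k^-2. *)
Lemma dyadic_sum_le (v : nat -> R) (n N J : nat) (G e : R) : (0 < n)%N ->
  (forall k, 0 <= v k) ->
  (forall m, \sum_(1 <= k < m) v k / k%:R ^+ 2 <= G) ->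
  (forall m, \sum_(N.+1 <= k < m) v k / k%:R ^+ 2 <= e) ->
  \sum_(j < J) (2 ^ j * n)%:R ^- 2 * \sum_(1 <= k < (2 ^ j * n).*2.+1) v k <=
    16 / 3 * ((N%:R / n%:R) ^+ 2 * G + e).
Proof.
move=> n0 v0 vG ve.
pose M := (2 ^ J * n)%N.
have n0' : 0 < n%:R :> R by rewrite ltr0n.
pose t j k : R := if (k <= (2 ^ j * n).*2)%N then (2 ^ j * n)%:R ^- 2 else 0.
have -> : \sum_(j < J) (2 ^ j * n)%:R ^- 2 * \sum_(1 <= k < (2 ^ j * n).*2.+1) v k =
    \sum_(1 <= k < M.+1) v k * \sum_(j < J) t j k.
  under [RHS]eq_bigr do rewrite mulr_sumr.
  rewrite [RHS]exchange_big/=; apply: eq_bigr => j _.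
  rewrite (@big_nat_widen _ _ _ _ _ M.+1); last first.
    by rewrite ltnS /M -mul2n mulnA -expnS leq_mul2r leq_exp2l// ltn_ord orbT.
  rewrite big_mkcond mulr_sumr; apply: eq_bigr => k _.
  by rewrite /t ltnS/=; case: ifP => _; rewrite ?mulr0// mulrC.
pose c k : R := (N%:R / n%:R) ^+ 2 + (N < k)%N%:R.
apply: (@le_trans _ _ (\sum_(1 <= k < M.+1) 16 / 3 * (v k / k%:R ^+ 2 * c k))).
  rewrite big_nat_cond [leRHS]big_nat_cond; apply: ler_sum => k /andP[/andP[k0 _] _].
  have k0' : 0 < k%:R :> R by rewrite ltr0n.
  rewrite (_ : 16 / 3 * _ = v k * (16 / 3 * (k%:R ^- 2 * c k))); last by field; rewrite gt_eqF.
  apply: ler_wpM2l => //; apply: le_trans (dyadic_weight_le _ n0 k0) _.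
  rewrite (_ : 16 / 3 * _ = 4 / 3 * (4 * (k%:R ^- 2 * c k))); last by field; rewrite gt_eqF.
  rewrite ler_pM2l// ge_min /c; case: ltnP => [Nk|kN]; apply/orP; [right|left].
    rewrite ler_pM2l//; apply: ler_peMr; first by rewrite invr_ge0 exprn_ge0// ltW.
    by rewrite lerDr sqr_ge0.
  rewrite addr0 (_ : _ * _ = n%:R ^- 2 * (4 * (N%:R / k%:R) ^+ 2)); last first.
    by field; rewrite !gt_eqF.
  apply: ler_peMr; first by rewrite invr_ge0 exprn_ge0// ltW.
  have : 1 <= N%:R / k%:R :> R by rewrite ler_pdivlMr// mul1r ler_nat.
  by move: (N%:R / k%:R) => x x1; nra.
rewrite -mulr_sumr ler_pM2l//.
under eq_bigr do rewrite mulrDr; rewrite big_split/=; apply: lerD.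
  by rewrite -mulr_suml mulrC ler_wpM2l ?sqr_ge0.
apply: le_trans (ve M.+1).
rewrite (@big_nat_widenl _ _ _ N.+1 1)//= [leRHS]big_mkcond/=.
by apply: ler_sum => k _; case: ifP => _; rewrite ?mulr1 ?mulr0.
Qed.

End dyadic.

(** * The strong law with a rate *)

Definition posr (R : realType) (x : R) : R := Num.max x 0%R.
Definition negr (R : realType) (x : R) : R := Num.max (- x)%R 0%R.

(** S_m is the difference of the two partial sums of parts.  These have the same
    mean, which can be subtracted from both. *)
Lemma deviation_decomposition d (T : measurableType d) (R : realType)
    (P : probability T R) (X : nat -> {RV P >-> R}) m (c : R) w :
  (forall k, (1 <= k)%N -> (X k : T -> R) \in Lfun P 2%:E /\ 'E_P[X k] = 0) ->
  (2 * c < `|S_ X m w|)%R ->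
  deviation P (fun k => @posr R \o X k) m c w \/
  deviation P (fun k => @negr R \o X k) m c w.
Proof.
move=> X2.
have Pfin : P [set: T] \is a fin_num := fin_num_measure P _ measurableT.
have part1 (f : R -> R) : measurable_fun [set: R] f -> (forall x, `|f x| <= `|x|)%R ->
    forall k, (1 <= k)%N -> f \o X k \in Lfun P 1.
  move=> mf fx k /X2[Xk _]; apply: Lfun_subset12 Pfin _ _.
  apply: Lfun2_dom Xk _; first exact: measurableT_comp.
  by move=> v; exact: fx.
set Yp := fun k => @posr R \o X k; set Yn := fun k => @negr R \o X k.
have Yp1 : forall k, (1 <= k)%N -> Yp k \in Lfun P 1.
  apply: part1; first exact: measurable_maxr.
  by move=> x; rewrite /posr /negr /Num.max; case: ifP => //; rewrite normr0.
have Yn1 : forall k, (1 <= k)%N -> Yn k \in Lfun P 1.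
  apply: part1; first by apply: measurable_maxr => //; exact: oppr_measurable.
  by move=> x; rewrite /posr /negr /Num.max; case: ifP => //; rewrite ?normr0 ?normrN.
have XE k : (Yp k \- Yn k = X k)%R.
  apply/funext => v; rewrite /Yp /Yn/= /posr /negr /Num.max oppr_lt0.
  by case: (ltgtP (X k v) 0%R) => [_|_|->]; rewrite ?oppr0 ?addr0 ?sub0r ?opprK.
have SE : S_ X m w = (psum Yp m w - psum Yn m w)%R.
  rewrite /psum -sumrB; apply: eq_bigr => k _; by rewrite -XE.
have EE : 'E_P[psum Yp m] = 'E_P[psum Yn m].
  rewrite !expectation_psum// big_nat_cond [RHS]big_nat_cond.
  apply: eq_bigr => k /andP[/andP[k1 _] _].
  have [_] := X2 k k1; rewrite -XE expectationB ?Yp1 ?Yn1// => /eqP.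
  by rewrite sube_eq ?add0e ?fin_num_adde_defr ?expectation_fin_num ?Yp1 ?Yn1// => /eqP.
rewrite /deviation/= EE SE !ltr_normr; set a := fine _.
case/orP => h; [case: (ltP c (psum Yp m w - a)%R) | case: (ltP c (psum Yn m w - a)%R)] => h1.
- by left.
- by right; apply/orP; right; lra.
- by right.
- by left; apply/orP; right; lra.
Qed.

(** The maximal inequality is used with eta = eps / 2 on each block, for both parts:
    2 * 40 / (1/2)^3 = 640.  The factor 16 / 3 comes from summing over the
    blocks. *)
Lemma sup_average_tail d (T : measurableType d) (R : realType)
    (P : probability T R) (X : nat -> {RV P >-> R}) (W G e eps : R) (N n : nat) :
  pairwise_independent_RV X ->
  (forall k, (1 <= k)%N -> 'E_P[X k] = 0 /\ 'V_P[X k] < +oo) ->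
  (1 <= W)%R ->
  (forall n : nat, (1 <= n)%N -> z_ X n * (n%:R^-1)%:E <= W%:E) ->
  (forall m, \sum_(1 <= k < m) fine 'V_P[X k] / k%:R ^+ 2 <= G)%R ->
  (forall m, \sum_(N.+1 <= k < m) fine 'V_P[X k] / k%:R ^+ 2 <= e)%R ->
  (0 < eps)%R -> (eps <= 1)%R -> (1 <= n)%N ->
  P [set w | eps%:E <
       ereal_sup [set (`|S_ X m w / m%:R|%R)%:E | m in [set m | (n <= m)%N]]]
    <= (640 * (16 / 3) * (W / eps ^+ 3) * ((N%:R / n%:R) ^+ 2 * G + e))%:E.
Proof.
move=> indX mom W1 zW vG ve e0 e1 n1.
have W0 : (0 < W)%R by exact: lt_le_trans W1.
have X2 k : (1 <= k)%N -> (X k : T -> R) \in Lfun P 2%:E.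
  by move=> /mom[]; exact: Lfun2_centered.
pose v k := fine 'V_P[X k].
have v0 k : (0 <= v k)%R by rewrite fine_ge0// variance_ge0.
pose eta := (eps / 2)%R.
have eta0 : (0 < eta)%R by rewrite divr_gt0.
have eta1 : (eta <= 1)%R by rewrite /eta; lra.
pose fp := @posr R; pose fn := @negr R.
have mfp : measurable_fun [set: R] fp by exact: measurable_maxr.
have mfn : measurable_fun [set: R] fn by apply: measurable_maxr => //; exact: oppr_measurable.
have fpx x : (0 <= fp x <= `|x|)%R by rewrite /fp /posr le_max lexx orbT/= ge_max ler_norm/=.
have fnx x : (0 <= fn x <= `|x|)%R by rewrite /fn /negr le_max lexx orbT/= ge_max -normrN ler_norm/=.
pose L j := (2 ^ j * n)%N.
have L0 j : (0 < L j)%N by rewrite muln_gt0 expn_gt0.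
pose E f j := exceedance P (fun k => f \o X k) (L j) (L j).*2 (eta * (L j)%:R).
pose A m := [set w | (eps < `|S_ X m w / m%:R|)%R].
have mX m : measurable_fun [set: T] (S_ X m) by exact: measurable_sum.
have mA m : measurable (A m).
  by apply: measurable_gt; apply: measurableT_comp => //; exact: measurable_funM.
(* Finitely many blocks at a time keep all bounds real; continuity from below
   recovers the whole event. *)
pose F J := \bigcup_(m in [set m | n <= m < L J]%N) A m.
have mF J : measurable (F J) by apply: bigcup_measurable.
have EF : [set w | eps%:E <
       ereal_sup [set (`|S_ X m w / m%:R|%R)%:E | m in [set m | (n <= m)%N]]] = \bigcup_J F J.
  apply/seteqP; split => w /=.
    move=> /ereal_sup_gt[_ [m /= nm <-]]; rewrite lte_fin => h.
    exists m => //; exists m => //=; rewrite nm /L.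
    by apply: leq_trans (ltn_expl m (ltnSn 1)) _; rewrite leq_pmulr.
  move=> [J _ [m /= /andP[nm _] h]].
  apply: lt_le_trans (ereal_sup_ubound _); last by exists m.
  by rewrite lte_fin.
pose U j := E fp j `|` E fn j.
have FE J : F J `<=` \big[setU/set0]_(j < J) U j.
  move=> w [m /= /andP[nm mJ] h]; rewrite -bigcup_mkord.
  have [j jJ /andP[jm mj]] : exists2 j, (j < J)%N & (L j <= m < (L j).*2)%N.
    elim: J mJ => [|J IH mJ]; first by rewrite /L mul1n ltnNge nm.
    have [/IH[j jJ hj]|Jm] := ltnP m (L J); first by exists j => //; exact: ltnW.
    by exists J; rewrite // Jm/= -mul2n /L mulnA -expnS.
  exists j => //; have X2' k : (1 <= k)%N -> (X k : T -> R) \in Lfun P 2%:E /\ 'E_P[X k] = 0.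
    by move=> k1; split; [exact: X2|have [] := mom k k1].
  have m0 : (0 < m%:R :> R)%R by rewrite ltr0n (leq_trans (L0 j)).
  have dev : (2 * (eta * (L j)%:R) < `|S_ X m w|)%R.
    rewrite (_ : 2 * _ = eps * (L j)%:R)%R; last by rewrite /eta; field.
    apply: (@le_lt_trans _ _ (eps * m%:R)%R); first by rewrite ler_pM2l// ler_nat.
    by move: h; rewrite /A/= normrM normfV (gtr0_norm m0) ltr_pdivlMr.
  by have [?|?] := deviation_decomposition X2' dev; [left|right]; exists m => //=; rewrite jm ltnW.
have mE (f : R -> R) j : measurable_fun [set: R] f -> (forall x, 0 <= f x <= `|x|)%R -> measurable (E f j).
  move=> mf fx; apply: measurable_exceedance => k k1.
  apply: Lfun2_dom (X2 k k1) _; first exact: measurableT_comp.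
  by move=> w /=; have /andP[h1 h2] := fx (X k w); rewrite ger0_norm.
pose D := (40 * W / eta ^+ 3)%R.
have PE (f : R -> R) j : measurable_fun [set: R] f -> (forall x, 0 <= f x <= `|x|)%R ->
    P (E f j) <= (D * ((L j)%:R ^- 2 * \sum_(1 <= k < (L j).*2.+1) v k))%:E.
  by move=> mf fx; exact: exceedance_transform.
have PF J : P (F J) <= (640 * (16 / 3) * (W / eps ^+ 3) * ((N%:R / n%:R) ^+ 2 * G + e))%:E.
  have mU j : measurable (U j) by apply: measurableU; exact: mE.
  apply: (le_trans (@content_subadditive _ _ _ P _ U J (fun j _ => mU j) (mF J) (FE J))).
  apply: (@le_trans _ _ (\sum_(j < J)
    (2 * D * ((L j)%:R ^- 2 * \sum_(1 <= k < (L j).*2.+1) v k))%:E)).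
    apply: lee_sum => j _; apply: (le_trans (measureU2 _ (mE _ j mfp fpx) (mE _ j mfn fnx))).
    by rewrite mulr2n !mulrDl !mul1r EFinD; apply: leeD; exact: PE.
  rewrite sumEFin lee_fin -mulr_sumr.
  have D0 : (0 < 2 * D)%R by rewrite !mulr_gt0// invr_gt0 exprn_gt0.
  apply: le_trans (ler_wpM2l (ltW D0) (dyadic_sum_le J n1 v0 vG ve)) _.
  move: ((N%:R / n%:R) ^+ 2 * G + e)%R => x.
  rewrite [leRHS](_ : _ = 2 * D * (16 / 3 * x))%R//.
  by rewrite /D /eta; field; rewrite gt_eqF.
rewrite EF.
have Fhomo : {homo F : i j / (i <= j)%N >-> (i <= j)%O}.
  move=> i j ij; apply/subsetPset; apply: bigcup_subset => m /= /andP[-> mi] /=.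
  by apply: leq_trans mi _; rewrite leq_mul2r leq_exp2l// ij orbT.
have cF := @nondecreasing_cvg_mu _ _ _ P F mF
  (bigcup_measurable (fun J _ => mF J)) Fhomo.
rewrite -(cvg_lim _ cF)//; apply: lime_le; first by apply/cvg_ex; eexists; exact: cF.
by apply: nearW => J; exact: PF.
Qed.

(* The factor [Num.max 1 (Psi _)] is [Psi _] as soon as [1 <= Psi _].  It cannot
   be replaced by [Psi _] for arbitrary positive rates: if X_1 = +-1 with
   probability 1/2 each and X_n = 0 for n >= 2, then e |-> c / (1 + e) is a rate
   for every c > 0, so a lower bound on n proportional to Psi would be void. *)
Theorem theorem1p10 (R : realType) :
  exists A B : R, (0 < A)%R /\ (0 < B)%R /\
  forall (d : measure_display) (T : measurableType d) (P : probability T R)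
    (X : nat -> {RV P >-> R}) (Gamma W : R) (Psi : R -> R),
  pairwise_independent_RV X ->
  (forall n : nat, (1 <= n)%N ->
     (X n : T -> R) \in Lfun P 1 /\ 'E_P[X n] = 0 /\ 'V_P[X n] < +oo) ->
  (1 <= Gamma)%R ->
  \sum_(1 <= n <oo) ('V_P[X n] * ((n%:R ^+ 2)^-1)%:E) <= Gamma%:E ->
  rate_of_convergence (fun n => 'V_P[X n] * ((n%:R ^+ 2)^-1)%:E) Psi ->
  strictly_decreasing_pos Psi ->
  (1 <= W)%R ->
  (forall n : nat, (1 <= n)%N -> z_ X n * (n%:R^-1)%:E <= W%:E) ->
  forall eps lambda : R, (0 < eps)%R -> (eps <= 1)%R -> (0 < lambda)%R ->
  forall n : nat, (1 <= n)%N ->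
  (A * Num.sqrt (W * Gamma / (lambda * eps ^+ 3)) *
     Num.max 1 (Psi (B * lambda * eps ^+ 3 / W)) <= n%:R)%R ->
  P [set w | eps%:E <
       ereal_sup [set (`|S_ X m w / m%:R|%R)%:E | m in [set m | (n <= m)%N]]]
    <= lambda%:E.
Proof.
exists 256%R, ((64 * 128)^-1)%R; split; first exact: ltr0n.
have B0 : (0 < (64 * 128)^-1 :> R)%R by rewrite invr_gt0 mulr_gt0// ltr0n.
split=> //.
move=> d T P X Gamma W Psi indX momX G1 VG rate _ W1 zW eps lambda e0 e1 l0 n n1 nA.
have W0 : (0 < W)%R by exact: lt_le_trans W1.
have G0 : (0 < Gamma)%R by exact: lt_le_trans G1.
have mom k : (1 <= k)%N -> 'E_P[X k] = 0 /\ 'V_P[X k] < +oo by move=> /momX[_].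
have X2 k : (1 <= k)%N -> (X k : T -> R) \in Lfun P 2%:E.
  by move=> /mom[]; exact: Lfun2_centered.
pose v k := fine 'V_P[X k].
have vE a m : (\sum_(a.+1 <= k < m) v k / k%:R ^+ 2)%:E =
    \sum_(a.+1 <= k < m) 'V_P[X k] * ((k%:R ^+ 2)^-1)%:E.
  rewrite -sumEFin big_nat_cond [RHS]big_nat_cond.
  apply: eq_bigr => k /andP[/andP[ak _] _].
  by rewrite EFinM fineK// variance_fin_num// X2// (leq_trans _ ak).
have xge0 k : 0 <= 'V_P[X k] * ((k%:R ^+ 2)^-1)%:E.
  by rewrite mule_ge0 ?variance_ge0// lee_fin invr_ge0 sqr_ge0.
have vG m : (\sum_(1 <= k < m) v k / k%:R ^+ 2 <= Gamma)%R.
  by rewrite -lee_fin vE; apply: le_trans VG; exact: nneseries_lim_ge.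
pose e := ((64 * 128)^-1 * lambda * eps ^+ 3 / W)%R.
have e_gt0 : (0 < e)%R by rewrite divr_gt0// mulr_gt0 ?exprn_gt0// mulr_gt0.
have [Psi0 Psie] := rate e e_gt0.
pose N := (Num.truncn (Psi e)).+1.
have PsiN : (Psi e <= N%:R)%R by rewrite ltW// truncnS_gt.
have ve m : (\sum_(N.+1 <= k < m) v k / k%:R ^+ 2 <= e)%R.
  by rewrite -lee_fin vE; apply: le_trans (Psie N PsiN); exact: nneseries_lim_ge.
have n0 : (0 < n%:R :> R)%R by rewrite ltr0n.
pose c := (W * Gamma / (lambda * eps ^+ 3))%R.
have c0 : (0 < c)%R by rewrite divr_gt0// mulr_gt0// exprn_gt0.
(* N <= Psi e + 1 <= 2 max(1, Psi e), and n >= 256 sqrt c max(1, Psi e), so that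
   N sqrt c / n <= 1 / 128. *)
have Nn : ((N%:R / n%:R) ^+ 2 * c <= 4 / 256 ^+ 2)%R.
  have NM : (N%:R <= 2 * Num.max 1 (Psi e))%R.
    have h1 : (1 <= Num.max 1 (Psi e))%R by rewrite le_max lexx.
    have h2 : (Psi e <= Num.max 1 (Psi e))%R by rewrite le_max lexx orbT.
    have /andP[h3 _] := truncn_itv (ltW Psi0).
    by rewrite /N -natr1; lra.
  have s0 : (0 < Num.sqrt c)%R by rewrite sqrtr_gt0.
  have h : (128 * (N%:R / n%:R * Num.sqrt c) <= 1)%R.
    rewrite (_ : 128 * _ = 128 * (N%:R * Num.sqrt c) / n%:R)%R; last by field; rewrite gt_eqF.
    rewrite ler_pdivrMr// mul1r; apply: le_trans nA; rewrite -/c -/e.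
    move: NM s0; move: (Num.sqrt c) (Num.max _ _) (N%:R : R) => s M x NM s0; nra.
  have h0 : (0 <= N%:R / n%:R * Num.sqrt c)%R by rewrite mulr_ge0// ltW.
  rewrite -(sqr_sqrtr (ltW c0)) -exprMn.
  by move: h h0; move: (N%:R / n%:R * Num.sqrt c)%R => x; nra.
apply: le_trans (sup_average_tail indX mom W1 zW vG ve e0 e1 n1) _.
(* At most lambda, since 640 * 16/3 * (4 / 256^2 + 1 / 8192) < 1. *)
rewrite lee_fin (_ : _ * _ = 640 * (16 / 3) *
  ((N%:R / n%:R) ^+ 2 * c + (64 * 128)^-1) * lambda)%R; last first.
  by rewrite /c /e; field; rewrite !gt_eqF.
apply: ler_piMl; first exact: ltW.
by move: Nn; move: ((N%:R / n%:R) ^+ 2 * c)%R => x; lra.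
Qed.
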